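(* Let $n\ge 5$. Among all polyomino chains with $n$ squares, the chains maximizing the augmented Zagreb index $AZI$ are exactly: the chain $AZ^1_{(n-1)/2}$ when $n$ is odd, and the chains of the family $AZ^2_{n/2}$ when $n$ is even. Moreover, the maximum value is $$M(n)=\frac{4456}{125}n-\frac{26763}{2000}-\frac{2312}{3375}\,I_{\{n\text{ even}\}},$$ where $I_{\{n\text{ even}\}}$ equals $1$ if $n$ is even and $0$ otherwise.
   Context: Polyomino chains (restricted model). For $n\ge 2$, a polyomino chain with $n$ squares is a sequence of closed unit squares $S_1,\dots,S_n$ in the plane with $S_1=[0,1]\times[0,1]$, $S_2=[1,2]\times[0,1]$, and for $k\ge 3$, $S_k=S_{k-1}+v_k$, where $v_2=(1,0)$ and each $v_k\in\{(1,0),(0,-1)\}$ satisfies $v_k=v_{k-1}$ if $L_k=1$ and $v_k\neq v_{k-1}$ if $L_k=2$. For $n\ge3$ the chain is determined by its link vector $(L_3,\dots,L_n)\in\{1,2\}^{n-2}$ and denoted $PC(L_3,\dots,L_n)$. Each chain is regarded as the graph whose vertices are the corners of the squares and whose edges are the sides of the squares. The augmented Zagreb index is $AZI(G)=\sum_{uv\in E(G)}\left(\frac{d_ud_v}{d_u+d_v-2}\right)^3$, where $d_u$ is the degree of $u$. Segments: a segment of a chain is a maximal run of consecutive squares $S_a,S_{a+1},\dots,S_b$ ($b>a$) lying in a common row or a common column; consecutive segments share exactly one square (a kink, where the chain changes direction), so a chain with $m$ segments of lengths (numbers of squares) $l_1,\dots,l_m$ satisfies $\sum l_i=n+m-1$.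 A segment is external if it contains $S_1$ or $S_n$, and internal otherwise. $AZ^1_m$ ($m\ge2$) denotes the polyomino chain with $m$ segments all of length 3; $AZ^2_m$ ($m\ge3$) denotes the family of polyomino chains with $m$ segments all of length 3 except exactly one internal segment of length 2. *)

(* Defs.v *)
From mathcomp Require Export all_boot all_order all_algebra.

Set Implicit Arguments.
Unset Strict Implicit.
Unset Printing Implicit Defensive.

Import Order.TTheory GRing.Theory Num.Theory.

Local Open Scope ring_scope.

Definition point : Type := (int * int)%type.

(* The closed unit square [x, x+1] * [y, y+1] is represented by its lower-left
   corner (x, y), and a chain S_1, ..., S_n by the sequence of its squares;
   S_k is thus the item of index k - 1. *)
Definition chain : Type := seq point.

Definition right : point := (1, 0).
Definition down : point := (0, -1).

Definition other_dir (v : point) : point := if v == right then down else right.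

(* [s] is the current square S_{k-1}, [v] the last displacement v_{k-1}, and
   [L] the list of the remaining links L_k, ..., L_n. *)
Fixpoint squares_from (s v : point) (L : seq nat) : chain :=
  if L is l :: L' then
    let v' := if l == 1%N then v else other_dir v in
    s :: squares_from (s.1 + v'.1, s.2 + v'.2) v' L'
  else [:: s].

Definition link_vector (n : nat) (L : seq nat) : bool :=
  ((size L).+2 == n) && all [pred l | (l == 1%N) || (l == 2)] L.

Definition PC (L : seq nat) : chain := (0, 0) :: squares_from (1, 0) right L.

Definition polyomino_chain (n : nat) (c : chain) : Prop :=
  exists2 L : seq nat, link_vector n L & c = PC L.

(* An undirected side is stored once, with its lower or left endpoint first, so
   that a side shared by two squares has a single representation. *)
Definition sides (s : point) : seq (point * point) :=
  let: (x, y) := s in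
  [:: ((x, y), (x + 1, y)); ((x, y + 1), (x + 1, y + 1));
      ((x, y), (x, y + 1)); ((x + 1, y), (x + 1, y + 1))].

(* The vertices of the graph are the corners, i.e., the endpoints of the edges. *)
Definition edges (c : chain) : seq (point * point) :=
  undup (flatten [seq sides s | s <- c]).

Definition deg (c : chain) (u : point) : nat :=
  count [pred e : point * point | (e.1 == u) || (e.2 == u)] (edges c).

(* All terms of the sum are rational, so the index takes its values in rat. *)
Definition AZI (c : chain) : rat :=
  \sum_(e <- edges c)
    (((deg c e.1)%:R * (deg c e.2)%:R)
       / ((deg c e.1)%:R + (deg c e.2)%:R - 2)) ^+ 3.

(* A run of consecutive squares is given by the pair (a, b) of the 0-based
   indices of its first and last squares. *)
Definition squares_of (c : chain) (r : nat * nat) : seq point :=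
  drop r.1 (take r.2.+1 c).

Definition aligned_run (c : chain) (r : nat * nat) : bool :=
  [&& (r.1 < r.2)%N, (r.2 < size c)%N
    & constant [seq s.1 | s <- squares_of c r]
      || constant [seq s.2 | s <- squares_of c r]].

Definition runs (c : chain) : seq (nat * nat) :=
  [seq r <- [seq (a, b) | a <- iota 0 (size c), b <- iota 0 (size c)]
     | aligned_run c r].

Definition segments (c : chain) : seq (nat * nat) :=
  [seq r <- runs c
     | all [pred r' | (r'.1 <= r.1)%N && (r.2 <= r'.2)%N ==> (r' == r)] (runs c)].

Definition seg_length (r : nat * nat) : nat := (r.2 - r.1).+1.

Definition external (c : chain) (r : nat * nat) : bool :=
  (r.1 == 0%N) || (r.2 == (size c).-1).

Definition internal (c : chain) (r : nat * nat) : bool := ~~ external c r.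

Definition AZ1 (m : nat) (c : chain) : Prop :=
  [/\ exists n, polyomino_chain n c,
      size (segments c) = m
    & forall r, r \in segments c -> seg_length r = 3].

Definition AZ2 (m : nat) (c : chain) : Prop :=
  [/\ exists n, polyomino_chain n c,
      size (segments c) = m
    & exists r, [/\ r \in segments c, internal c r, seg_length r = 2
      & forall r', r' \in segments c -> r' <> r -> seg_length r' = 3]].

Definition maximizes_AZI (n : nat) (c : chain) : Prop :=
  polyomino_chain n c /\
  forall c', polyomino_chain n c' -> AZI c' <= AZI c.

(* 4456/125 n - 26763/2000 - 2312/3375 I_{n even}; 26763 is split because a
   numeral of that size overflows the stack (numerals are unary here). *)
Definition maxAZI (n : nat) : rat :=
  4456 / 125 * n%:R - (26 * 1000 + 763) / 2000 - 2312 / 3375 * (~~ odd n)%:R.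

(* Main.v *)
(* Every step of a chain raises x - y by one, so a corner at level l only lies on
   squares at levels l - 1, l and l + 1, and the end degrees of an edge depend on
   four consecutive squares.  Hence an index that sums a function of the end degrees
   over the edges is determined by its values on chains of three and four squares:
   it is affine in n up to a cost for each pair of adjacent squares, which vanishes
   unless both squares are medial, both are kinks, or one is terminal and the other a
   kink.  Collected along the segments, these costs vanish exactly on the segments
   of length 3.  The lengths minus one add up to n - 1, so for even n some segment
   has another length, and the cheapest choice for AZI is a single internal segment
   of length 2. *)
Require Import Defs.
From mathcomp Require Import zify ring lra.

Set Implicit Arguments.
Unset Strict Implicit.
Unset Printing Implicit Defensive.

Import Order.TTheory GRing.Theory Num.Theory.

Section DegreeIndex.

Local Open Scope ring_scope.

Implicit Types (a b c : chain) (e : point * point) (P : pred (point * point)).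

Lemma edges_cat a b : edges (a ++ b) = [seq e <- edges a | e \notin edges b] ++ edges b.
Proof.
rewrite /edges map_cat flatten_cat undup_cat; congr (_ ++ _).
by apply: eq_filter => e; rewrite mem_undup.
Qed.

Lemma mem_edges c e : reflect (exists2 s, s \in c & e \in sides s) (e \in edges c).
Proof. by rewrite mem_undup; apply: flatten_mapP. Qed.

Lemma eq_mem_edges a b : a =i b -> edges a =i edges b.
Proof.
by move=> eq_ab e; apply/mem_edges/mem_edges => -[s s_in e_in];
  exists s; rewrite // ?eq_ab // -eq_ab.
Qed.

Lemma perm_edges a b : a =i b -> perm_eq (edges a) (edges b).
Proof. by move=> eq_ab; apply: uniq_perm (eq_mem_edges eq_ab); apply: undup_uniq. Qed.

Lemma eq_deg a b : a =i b -> deg a =1 deg b.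
Proof. by move=> eq_ab u; apply/permP/perm_edges. Qed.

Lemma deg_eq0P c u :
  reflect (forall e, e \in edges c -> u != e.1 /\ u != e.2) (deg c u == 0%N).
Proof.
rewrite /deg eqn0Ngt -has_count -all_predC.
apply: (iffP allP) => untouched e /untouched /=.
  by rewrite negb_or ![u == _]eq_sym => /andP.
by rewrite negb_or ![_ == u]eq_sym => -[-> ->].
Qed.

Lemma deg_catr a b u : deg a u = 0%N -> deg (a ++ b) u = deg b u.
Proof.
rewrite /deg edges_cat count_cat count_filter; set touches := [pred e | _].
move=> /eqP; rewrite eqn0Ngt -has_count => /hasPn no_touch.
rewrite [X in (X + _)%N](_ : _ = 0%N) //; apply/eqP.
by rewrite eqn0Ngt -has_count; apply/hasPn => e /no_touch /= /negPf->.
Qed.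

Definition avoids c : pred (point * point) :=
  [pred e | (deg c e.1 == 0%N) && (deg c e.2 == 0%N)].

Lemma avoids_notin c e : avoids c e -> e \notin edges c.
Proof.
by case/andP => /deg_eq0P untouched _; apply/negP => /untouched[]; rewrite eqxx.
Qed.

Variables (V : nmodType) (f : nat -> nat -> V).

Definition degree_index_on P c : V :=
  \sum_(e <- edges c | P e) f (deg c e.1) (deg c e.2).

Definition degree_index c : V := \sum_(e <- edges c) f (deg c e.1) (deg c e.2).

Lemma degree_index_split P c :
  degree_index c = degree_index_on P c + degree_index_on (predC P) c.
Proof. exact: bigID. Qed.

Lemma eq_degree_index_on P a b : a =i b -> degree_index_on P a = degree_index_on P b.
Proof.
move=> eq_ab; rewrite /degree_index_on (perm_big _ (perm_edges eq_ab)).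
by apply: eq_bigr => e _; rewrite !(eq_deg eq_ab).
Qed.

Lemma degree_index_on_catr P a b :
    {in edges (a ++ b), forall e, P e -> avoids a e} ->
  degree_index_on P (a ++ b) = degree_index_on P b.
Proof.
move=> P_avoids; rewrite /degree_index_on edges_cat big_cat big1_seq /= ?add0r.
  rewrite big_seq_cond [RHS]big_seq_cond; apply: eq_bigr => e /andP[e_in Pe].
  have /P_avoids/(_ Pe)/andP[/eqP deg_a1 /eqP deg_a2] : e \in edges (a ++ b).
    by rewrite edges_cat mem_cat e_in orbT.
  by rewrite !deg_catr.
move=> e /andP[Pe e_in].
have /P_avoids/(_ Pe)/avoids_notin : e \in edges (a ++ b).
  by rewrite edges_cat mem_cat e_in.
by move: e_in; rewrite mem_filter => /andP[_ ->].
Qed.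

Lemma degree_index_on_catl P a b :
    {in edges (a ++ b), forall e, P e -> avoids b e} ->
  degree_index_on P (a ++ b) = degree_index_on P a.
Proof.
have swap : a ++ b =i b ++ a by move=> s; rewrite !mem_cat orbC.
move=> P_avoids; rewrite (eq_degree_index_on P swap) degree_index_on_catr // => e.
by rewrite -(eq_mem_edges swap); apply: P_avoids.
Qed.

Lemma degree_index_glue a b c :
    {in edges (a ++ b ++ c), forall e, avoids a e || avoids c e} ->
  degree_index (a ++ b ++ c) + degree_index b
    = degree_index (a ++ b) + degree_index (b ++ c).
Proof.
move=> far; rewrite !(degree_index_split (avoids a)).
rewrite !(@degree_index_on_catr (avoids a) a) //.
have meets_far : {in edges (a ++ b ++ c), forall e, ~~ avoids a e -> avoids c e}.
  by move=> e /far /orP[->|].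
rewrite catA in meets_far *; rewrite !(@degree_index_on_catl (predC _) _ c) //.
  by rewrite addrACA [RHS]addrC [in RHS]addrACA; congr (_ + _); rewrite addrC.
move=> e e_in; apply: meets_far.
by move: e_in; rewrite -catA [in X in _ -> X]edges_cat mem_cat orbC => ->.
Qed.

End DegreeIndex.

Section Translation.

Local Open Scope ring_scope.

Variables (V : nmodType) (f : nat -> nat -> V) (v : point).

Lemma sides_translate (s : point) : sides (s + v) = [seq e + (v, v) | e <- sides s].
Proof. by case: s v => x y [x' y'] /=; rewrite !(addrAC _ _ 1). Qed.

Lemma edges_translate (c : chain) :
  edges [seq s + v | s <- c] = [seq e + (v, v) | e <- edges c].
Proof.
rewrite /edges -(undup_map_inj (addIr (v, v))) map_flatten -!map_comp.
by congr (undup (flatten _)); apply: eq_map => s; apply: sides_translate.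
Qed.

Lemma deg_translate (c : chain) (u : point) :
  deg [seq s + v | s <- c] (u + v) = deg c u.
Proof.
rewrite /deg edges_translate count_map; apply: eq_count => e /=.
by rewrite !(inj_eq (addIr v)).
Qed.

Lemma degree_index_translate (c : chain) :
  degree_index f [seq s + v | s <- c] = degree_index f c.
Proof.
rewrite /degree_index edges_translate big_map.
by apply: eq_bigr => e _; rewrite !deg_translate.
Qed.

End Translation.

Section Levels.

Local Open Scope ring_scope.

Definition level (p : point) : int := p.1 - p.2.

Lemma level_sides (s : point) (e : point * point) : e \in sides s ->
  [/\ level s - 1 <= level e.1 <= level s + 1,
      level s - 1 <= level e.2 <= level s + 1
    & level e.1 - 1 <= level e.2 <= level e.1 + 1].
Proof.
case: s => x y; rewrite !inE /level => /or4P[] /eqP-> /=;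
by split; apply/andP; split; lia.
Qed.

Lemma deg_below (l : int) (c : chain) (u : point) :
  {in c, forall s, l <= level s} -> level u + 1 < l -> deg c u = 0%N.
Proof.
move=> c_above u_below; apply/eqP/deg_eq0P => e /mem_edges[s /c_above le_ls].
by case/level_sides=> /andP[le_e1 _] /andP[le_e2 _] _; split; apply/eqP=> eq_u;
  rewrite -eq_u in le_e1 le_e2; lia.
Qed.

Lemma deg_above (l : int) (c : chain) (u : point) :
  {in c, forall s, level s <= l} -> l + 1 < level u -> deg c u = 0%N.
Proof.
move=> c_below u_above; apply/eqP/deg_eq0P => e /mem_edges[s /c_below le_sl].
by case/level_sides=> /andP[_ ge_e1] /andP[_ ge_e2] _; split; apply/eqP=> eq_u;
  rewrite -eq_u in ge_e1 ge_e2; lia.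
Qed.

Lemma degree_index_glue_levels (V : nmodType) (f : nat -> nat -> V) (l : int)
    (a b c : chain) :
    {in a, forall s, level s <= l} -> {in c, forall s, l + 4 <= level s} ->
  degree_index f (a ++ b ++ c) + degree_index f b
    = degree_index f (a ++ b) + degree_index f (b ++ c).
Proof.
move=> a_below c_above; apply: degree_index_glue => -[p q].
case/mem_edges=> s _ /level_sides[_ _ /= /andP[le_pq le_qp]].
have [low|high] := lerP (level p + level q) (l + l + 4).
  by rewrite orbC /avoids /= !(deg_below c_above) //; lia.
by rewrite /avoids /= !(deg_above a_below) //; lia.
Qed.

End Levels.

Section Scanl.

Variables (T1 T2 : Type) (g : T1 -> T2 -> T1).

Lemma take_scanl (n : nat) (x : T1) (s : seq T2) :
  take n (scanl g x s) = scanl g x (take n s).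
Proof. by elim: s n x => [|y s IHs] [|n] x //=; rewrite IHs. Qed.

Lemma drop_cons_scanl (n : nat) (x : T1) (s : seq T2) : n <= size s ->
  exists y, drop n (x :: scanl g x s) = y :: scanl g y (drop n s).
Proof.
elim: s n x => [|y s IHs] [|n] x //= le_ns; [by exists x | by exists x |].
exact: IHs.
Qed.

End Scanl.

Section Walks.

Local Open Scope ring_scope.

Definition step (d : bool) : point := if d then down else right.

Definition walk (p : point) (ds : seq bool) : chain :=
  p :: scanl (fun q d => q + step d) p ds.

(* [t] tells, for each square but the first and the last one, whether the direction
   changes there. *)
Definition directions (x : bool) (t : seq bool) : seq bool := x :: scanl addb x t.

Definition chain_of_turns (t : seq bool) : chain := walk 0 (directions false t).

Lemma size_chain_of_turns (t : seq bool) : size (chain_of_turns t) = (size t).+2.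
Proof. by rewrite /= !size_scanl. Qed.

Lemma squares_from_walk (s : point) (x : bool) (L : seq nat) :
  squares_from s (step x) L = walk s (scanl addb x [seq l != 1%N | l <- L]).
Proof.
elim: L s x => //= l L IHL s x; congr (_ :: _).
by rewrite -[RHS]IHL; case: (l == 1%N); case: x.
Qed.

Lemma PC_chain_of_turns (L : seq nat) : PC L = chain_of_turns [seq l != 1%N | l <- L].
Proof. by rewrite /PC -[right]/(step false) squares_from_walk. Qed.

Lemma polyomino_chainP (n : nat) (c : chain) :
  polyomino_chain n c <-> exists2 t, (size t).+2 = n & c = chain_of_turns t.
Proof.
split=> [[L /andP[/eqP <- _] ->]|[t <- ->]].
  by exists [seq l != 1%N | l <- L]; rewrite ?size_map ?PC_chain_of_turns.
pose L := [seq if x then 2%N else 1%N | x <- t]; exists L.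
  by rewrite /link_vector size_map eqxx /=; apply/allP => _ /mapP[[] _ ->].
by rewrite PC_chain_of_turns -map_comp map_id_in // => -[].
Qed.

Lemma level_step (p : point) (d : bool) : level (p + step d) = level p + 1.
Proof. by case: p d => x y []; rewrite /level /=; lia. Qed.

Lemma level_walk (p : point) (ds : seq bool) :
  {in walk p ds, forall s, level p <= level s}.
Proof.
elim: ds p => [|d ds IHds] p s; first by rewrite mem_seq1 => /eqP->.
by rewrite [walk p _]/= inE => /predU1P[->//|/IHds]; rewrite level_step; lia.
Qed.

Lemma walk_translate (v p : point) (ds : seq bool) :
  walk (p + v) ds = [seq s + v | s <- walk p ds].
Proof.
by elim: ds p => //= d ds IHds p; congr (_ :: _); rewrite -[RHS]IHds addrAC.
Qed.

Variables (V : nmodType) (f : nat -> nat -> V).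

Lemma degree_index_walk (p : point) (ds : seq bool) :
  degree_index f (walk p ds) = degree_index f (walk 0 ds).
Proof. by rewrite -[p in LHS]add0r walk_translate degree_index_translate. Qed.

Lemma degree_index_walk_glue (d1 d2 d3 : bool) (ds : seq bool) :
  degree_index f (walk 0 [:: d1, d2, d3 & ds]) + degree_index f (walk 0 [:: d2; d3])
    = degree_index f (walk 0 [:: d1; d2; d3])
      + degree_index f (walk 0 [:: d2, d3 & ds]).
Proof.
pose p1 : point := 0 + step d1; pose p2 := p1 + step d2; pose p3 := p2 + step d3.
rewrite -(degree_index_walk p1 [:: d2; d3]) -(degree_index_walk p1 [:: d2, d3 & ds]).
apply: (@degree_index_glue_levels V f 0 [:: 0] [:: p1; p2; p3] (behead (walk p3 ds))).
  by move=> s; rewrite mem_seq1 => /eqP->.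
by case: ds => [|d ds] // s /level_walk; rewrite !level_step.
Qed.

End Walks.

Section ConsecutivePairs.

Implicit Types (a u v : nat) (ks : seq nat).

Lemma all_pairmap_pair (T : Type) (e : rel T) (x : T) (s : seq T) :
  all (fun r => e r.1 r.2) (pairmap pair x s) = path e x s.
Proof. by elim: s x => //= y s IHs x; rewrite IHs. Qed.

Lemma pairmap_pair_uniq (T : eqType) (x : T) (s : seq T) :
  uniq s -> uniq (pairmap pair x s).
Proof.
suff {1}<- : unzip2 (pairmap pair x s) = s by apply: map_uniq.
by elim: s x => //= y s IHs x; rewrite IHs.
Qed.

Lemma mem_pairmap_pair a ks u v : path ltn a ks ->
  (u, v) \in pairmap pair a ks <->
  [/\ u < v, u \in a :: ks, v \in a :: ks & {in ks, forall j, ~~ (u < j < v)}].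
Proof.
elim: ks a => [|k ks IHks] a.
  move=> _; rewrite in_nil; split=> // -[lt_uv].
  by rewrite !mem_seq1 => /eqP u_a /eqP v_a; rewrite u_a v_a ltnn in lt_uv.
move=> /andP[lt_ak k_ks]; have /allP above_k := order_path_min ltn_trans k_ks.
rewrite [pairmap _ _ _]/= inE; split.
  case/predU1P=> [[-> ->]|/(IHks _ k_ks)[lt_uv u_in v_in between]].
    split; rewrite ?mem_head 1?inE ?mem_head ?orbT // => j.
    by rewrite inE => /predU1P[->|/above_k /=]; lia.
  split; rewrite 1?inE ?u_in ?v_in ?orbT // => j; rewrite inE.
  case/predU1P=> [->|/between //]; move: u_in; rewrite inE.
  by case/predU1P=> [->|/above_k /=]; lia.
case=> lt_uv u_in v_in between; apply/predU1P.
have v_in_ks : v \in k :: ks.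
  move: v_in; rewrite inE => /predU1P[v_a|//]; move: lt_uv u_in; rewrite v_a => lt_ua.
  by rewrite !inE => /or3P[/eqP|/eqP|/above_k /=]; lia.
move: u_in; rewrite inE => /predU1P[u_a|u_in]; [left | right].
  congr (_, _) => //; have := between k (mem_head _ _); rewrite u_a.
  by move: v_in_ks; rewrite inE => /predU1P[//|/above_k /=]; lia.
by apply/IHks => //; split=> // j j_in; apply: between; rewrite inE j_in orbT.
Qed.

Lemma big_pairmap_pair (T : Type) (idx : T) (op : Monoid.law idx) (F : nat -> T) a ks :
  path leq a ks ->
  \big[op/idx]_(r <- pairmap pair a ks) \big[op/idx]_(r.1 <= j < r.2) F j
    = \big[op/idx]_(a <= j < last a ks) F j.
Proof.
elim: ks a => [|k ks IHks] a /=; first by rewrite big_nil big_geq.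
case/andP=> le_ak path_ks; rewrite big_cons IHks // -big_cat_nat //=.
have /allP above_k := order_path_min leq_trans path_ks.
by have := mem_last k ks; rewrite inE => /predU1P[->|/above_k].
Qed.

End ConsecutivePairs.

Inductive square_kind := Terminal | Medial | Kink.

(* Squares are numbered from 0: item j - 1 of [t] describes square j, and the default
   value of [nth] makes the last square, number (size t).+1, terminal. *)
Definition kind (t : seq bool) (j : nat) : square_kind :=
  nth Terminal (Terminal :: [seq if x then Kink else Medial | x <- t]) j.

Definition medial (t : seq bool) (j : nat) : bool :=
  if kind t j is Medial then true else false.

Section SquareKinds.

Implicit Types (t : seq bool) (j : nat).

Lemma medialP t j : medial t j -> kind t j = Medial.
Proof. by rewrite /medial; case: kind. Qed.

Lemma medialS t j : j < size t -> medial t j.+1 = ~~ nth false t j.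
Proof. by move=> lt_j; rewrite /medial /kind /= (nth_map false) //; case: nth. Qed.

Lemma medial_oversize t j : size t < j -> medial t j = false.
Proof. by move=> lt_j; rewrite /medial /kind nth_default //= size_map. Qed.

Lemma medial_mkseq (is_break : pred nat) (k : nat) j :
  medial (mkseq (is_break \o succn) k) j = (0 < j <= k) && ~~ is_break j.
Proof.
case: j => // j.
case: (leqP j.+1 k) => [lt_jk|ge_jk]; last by rewrite medial_oversize // size_mkseq.
by rewrite medialS ?size_mkseq // nth_mkseq.
Qed.

Lemma kind_break t j : j <= (size t).+1 -> ~~ medial t j ->
  kind t j = if (j == 0) || (j == (size t).+1) then Terminal else Kink.
Proof.
rewrite /medial; case: j => // j; rewrite ltnS leq_eqVlt => /predU1P[->|lt_j].
  by rewrite /kind nth_default /= ?size_map ?eqxx.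
by rewrite /kind /= eqSS (ltn_eqF lt_j) (nth_map false) //; case: nth.
Qed.

End SquareKinds.

Section ClosedForm.

Local Open Scope ring_scope.

Variables (R : comNzRingType) (f : nat -> nat -> R).

(* These are solved from the indices of the chains with three and four squares. *)
Definition square_weight : R := f 2 3 + 2 * f 3 4.
Definition base_weight : R := 2 * f 2 2 + f 2 3 + 4 * f 3 3 - 6 * f 3 4.

Definition medial_medial_cost : R := f 2 3 + 2 * f 3 4 - 3 * f 3 3.
Definition kink_kink_cost : R := f 2 3 + 2 * f 3 4 - 2 * f 2 4 - f 4 4.
Definition terminal_kink_cost : R := 2 * f 3 3 - f 2 4 - f 3 4.

Definition link_cost (x y : square_kind) : R :=
  match x, y with
  | Medial, Medial => medial_medial_cost
  | Kink, Kink => kink_kink_cost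
  | Terminal, Kink | Kink, Terminal => terminal_kink_cost
  | _, _ => 0
  end.

Definition turn_cost (t : seq bool) : R :=
  \sum_(0 <= j < (size t).+1) link_cost (kind t j) (kind t j.+1).

Lemma turn_cost_glue (a b : bool) (t : seq bool) :
  turn_cost [:: a, b & t] + turn_cost [:: b] = turn_cost [:: a; b] + turn_cost (b :: t).
Proof.
pose ka := kind [:: a] 1; pose kb := kind [:: b] 1.
pose d := link_cost Terminal ka + link_cost ka kb - link_cost Terminal kb.
have cons2 t' : turn_cost [:: a, b & t'] = d + turn_cost (b :: t').
  rewrite /turn_cost 2?big_nat_recl // [in RHS]big_nat_recl //.
  by rewrite [RHS]addrA subrK addrA.
by rewrite !cons2 addrAC.
Qed.

Hypothesis fC : commutative f.

(* Free of [f], so that it can be evaluated on a concrete chain. *)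
Definition degree_types (c : chain) : seq (nat * nat) :=
  [seq (deg c e.1, deg c e.2) | e <- edges c].

Lemma degree_index_types (c : chain) :
  degree_index f c = \sum_(ij <- degree_types c) f ij.1 ij.2.
Proof. by rewrite big_map. Qed.

Lemma degree_index_directions_small (x : bool) (t : seq bool) : (0 < size t <= 2)%N ->
  degree_index f (walk 0 (directions x t))
    = square_weight * (size t).+2%:R + base_weight - turn_cost t.
Proof.
rewrite degree_index_types /turn_cost /square_weight /base_weight.
by case: t => [|[] [|[] []]] //= _; rewrite !big_nat_recl // big_geq //;
  case: x; set ij := degree_types _; vm_compute in ij; rewrite /ij;
  rewrite !big_cons big_nil /= ?(fC 3 2) ?(fC 4 2) ?(fC 4 3)
    /medial_medial_cost /terminal_kink_cost /kink_kink_cost; ring.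
Qed.

(* Both sides satisfy the same gluing identity. *)
Lemma degree_index_directions (x : bool) (t : seq bool) : (0 < size t)%N ->
  degree_index f (walk 0 (directions x t))
    = square_weight * (size t).+2%:R + base_weight - turn_cost t.
Proof.
case: t => // a t _; elim: t x a => [|b t IHt] x a.
  exact: degree_index_directions_small.
set y := x (+) a.
have index_glue : degree_index f (walk 0 (directions x [:: a, b & t]))
      + degree_index f (walk 0 (directions y [:: b]))
    = degree_index f (walk 0 (directions x [:: a; b]))
      + degree_index f (walk 0 (directions y (b :: t))).
  exact: degree_index_walk_glue.
rewrite (canRL (addrK _) index_glue) (canRL (addrK _) (turn_cost_glue a b t)).
rewrite IHt (@degree_index_directions_small x [:: a; b] isT).
rewrite (@degree_index_directions_small y [:: b] isT) /=.
by rewrite -[(size t).+4%:R]natr1; ring.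
Qed.

End ClosedForm.

Section Segments.

Implicit Types (c : chain) (r : nat * nat) (t : seq bool).

Lemma mem_runs c r : (r \in runs c) = aligned_run c r.
Proof.
rewrite mem_filter andb_idr //; case: r => u v /and3P[/= lt_uv lt_v _].
by apply/allpairsP; exists (u, v); rewrite !mem_iota /=; split=> //; lia.
Qed.

Lemma segments_uniq c : uniq (segments c).
Proof.
rewrite !filter_uniq // allpairs_uniq ?iota_uniq //.
by move=> [? ?] [? ?] _ _.
Qed.

Lemma segmentP c r :
  reflect
    (aligned_run c r /\
     forall r', aligned_run c r' -> r'.1 <= r.1 -> r.2 <= r'.2 -> r' = r)
    (r \in segments c).
Proof.
rewrite mem_filter mem_runs andbC; apply: (iffP andP) => -[r_run r_max]; split=> //.
  move=> r'; rewrite -mem_runs => /(allP r_max) /= /implyP r'_max le_start le_end.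
  by apply/eqP/r'_max; rewrite le_start.
apply/allP => r'; rewrite mem_runs => r'_run.
by apply/implyP => /andP[le_start le_end]; apply/eqP/r_max.
Qed.

Lemma seg_length_gt1 c r : r \in segments c -> 1 < seg_length r.
Proof. by case/segmentP=> /and3P[lt_r _ _] _; rewrite ltnS subn_gt0. Qed.

Lemma constant_partial_sums (V : zmodType) (x : V) (s : seq V) :
  constant (x :: scanl +%R x s) = all (pred1 0%R) s.
Proof.
elim: s x => //= y s IHs x; rewrite -[in LHS]subr_eq0 addrAC subrr add0r.
by case: eqP => //= ->; rewrite addr0; apply: IHs.
Qed.

Lemma map_fst_walk (p : point) (ds : seq bool) :
  [seq s.1 | s <- walk p ds] = p.1 :: scanl +%R p.1 [seq (step d).1 | d <- ds].
Proof. by elim: ds p => // d ds IHds p; congr (_ :: _); apply: IHds. Qed.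

Lemma map_snd_walk (p : point) (ds : seq bool) :
  [seq s.2 | s <- walk p ds] = p.2 :: scanl +%R p.2 [seq (step d).2 | d <- ds].
Proof. by elim: ds p => // d ds IHds p; congr (_ :: _); apply: IHds. Qed.

Lemma constant_walk (p : point) (ds : seq bool) :
  constant [seq s.1 | s <- walk p ds] || constant [seq s.2 | s <- walk p ds]
    = constant ds.
Proof.
rewrite map_fst_walk map_snd_walk !constant_partial_sums !all_map.
by case: ds => // -[] ds /=; rewrite ?orbF; apply: eq_all => -[].
Qed.

Lemma constant_directions (x : bool) t : constant (directions x t) = all negb t.
Proof.
elim: t x => //= a t IHt x; case: a => /=; last by rewrite addbF eqxx IHt.
by case: x.
Qed.

Lemma squares_of_chain_of_turns t u v : u <= v <= size t ->
  exists p x, squares_of (chain_of_turns t) (u, v.+1)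
    = walk p (directions x (drop u (take v t))).
Proof.
case/andP=> le_uv le_v; have size_v : size (take v t) = v by rewrite size_takel.
have [|x drop_x] := @drop_cons_scanl _ _ addb u false (take v t).
  by rewrite size_v.
pose ds := directions false (take v t).
have [//|p drop_p] := @drop_cons_scanl _ _ (fun q d => q + step d)%R u (0 : point)%R ds.
  by rewrite /= size_scanl size_v leqW.
exists p, x; rewrite /directions -drop_x -[RHS]drop_p; congr drop.
by rewrite /chain_of_turns /walk /directions [LHS]/= take_scanl /= take_scanl.
Qed.

Lemma aligned_run_turns t u v :
  aligned_run (chain_of_turns t) (u, v.+1)
    = [&& u <= v, v <= size t & all negb (drop u (take v t))].
Proof.
rewrite /aligned_run size_chain_of_turns !ltnS; case: leqP => //= le_uv.
case: leqP => //= le_v; have [|p [x ->]] := @squares_of_chain_of_turns t u v.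
  by rewrite le_uv.
by rewrite constant_walk constant_directions.
Qed.

Lemma aligned_runP t u v :
  reflect [/\ u < v, v <= (size t).+1 & forall j, u < j < v -> medial t j]
    (aligned_run (chain_of_turns t) (u, v)).
Proof.
case: v => [|v]; first by right; case.
rewrite aligned_run_turns !ltnS.
apply: (iffP and3P) => -[le_uv le_v straight]; split=> //.
  case=> // j /andP[lt_uj lt_jv]; rewrite medialS; last by lia.
  have := all_nthP false straight (j - u).
  by rewrite size_drop size_takel // nth_drop subnKC // nth_take //; apply; lia.
apply/(all_nthP false) => j; rewrite size_drop size_takel // => lt_j.
by rewrite nth_drop nth_take -?medialS ?straight //; lia.
Qed.

Lemma mem_segments t u v :
  (u, v) \in segments (chain_of_turns t) <->
  [/\ u < v <= (size t).+1, ~~ medial t u, ~~ medial t v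
    & forall j, u < j < v -> medial t j].
Proof.
split.
  case/segmentP=> /aligned_runP[lt_uv le_v straight] max_uv.
  split=> //; first (by rewrite lt_uv); apply/negP => medial_end.
    have u_gt0 : 0 < u by rewrite lt0n; apply: contraTneq medial_end => ->.
    suff [] : (u.-1, v) = (u, v) by lia.
    apply: max_uv; rewrite ?leq_pred //.
    apply/aligned_runP; split=> // [|j /andP[lt_uj lt_jv]]; first by lia.
    have [->|ne_ju] := eqVneq j u; rewrite // straight ?lt_jv //; lia.
  have lt_v : v < (size t).+1.
    by rewrite ltnNge; apply: contraL medial_end => /medial_oversize ->.
  suff [] : (u, v.+1) = (u, v) by lia.
  apply: max_uv; rewrite ?leqnSn //.
  apply/aligned_runP; split=> // [|j /andP[lt_uj lt_jv]]; first by lia.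
  have [->|ne_jv] := eqVneq j v; rewrite // straight ?lt_uj //; lia.
case=> /andP[lt_uv le_v] break_u break_v straight.
apply/segmentP; split; first exact/aligned_runP.
case=> u' v' /aligned_runP[lt_u'v' le_v' straight'] /= le_u'u le_vv'.
congr (_, _); apply/eqP.
  rewrite eqn_leq le_u'u /= leqNgt; apply: contra break_u => lt_u'u.
  by apply: straight'; rewrite lt_u'u (leq_trans lt_uv).
rewrite eqn_leq le_vv' andbT leqNgt; apply: contra break_v => lt_vv'.
by apply: straight'; rewrite lt_vv' andbT (leq_ltn_trans le_u'u).
Qed.

(* The kinks and the last square; segments are delimited by these and square 0. *)
Definition breaks t : seq nat := [seq j <- iota 1 (size t).+1 | ~~ medial t j].

Lemma breaks_path t : path ltn 0 (breaks t).
Proof. exact: (path_filter ltn_trans _ (iota_ltn_sorted 0 (size t).+2)). Qed.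

Lemma mem_breaks t j : (j \in 0 :: breaks t) = (j <= (size t).+1) && ~~ medial t j.
Proof.
by rewrite inE mem_filter mem_iota add1n ltnS; case: j => // j; rewrite andbC.
Qed.

Lemma last_breaks t : last 0 (breaks t) = (size t).+1.
Proof.
rewrite /breaks -[X in iota 1 X]addn1 iotaD add1n filter_cat /=.
by rewrite medial_oversize // last_cat.
Qed.

Lemma perm_segments t :
  perm_eq (segments (chain_of_turns t)) (pairmap pair 0 (breaks t)).
Proof.
have breaks_ltn := breaks_path t.
apply: uniq_perm; first exact: segments_uniq.
  by apply: pairmap_pair_uniq; rewrite filter_uniq ?iota_uniq.
move=> [u v]; apply/idP/idP.
  case/mem_segments=> /andP[lt_uv le_v] break_u break_v straight.
  apply/mem_pairmap_pair => //; rewrite !mem_breaks break_u break_v !andbT.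
  split=> // [|j]; first by lia.
  by rewrite mem_filter => /andP[break_j _]; apply: contra break_j; apply: straight.
case/mem_pairmap_pair=> // lt_uv.
rewrite !mem_breaks => /andP[_ break_u] /andP[le_v break_v] between.
apply/mem_segments; split=> // [|j lt_ujv]; first by rewrite lt_uv.
have : j \notin breaks t by apply/negP => /between; rewrite lt_ujv.
by rewrite mem_filter mem_iota; case: medial => //=; lia.
Qed.

Lemma big_segments (T : Type) (idx : T) (op : Monoid.com_law idx) (F : nat -> T) t :
  \big[op/idx]_(r <- segments (chain_of_turns t)) \big[op/idx]_(r.1 <= j < r.2) F j
    = \big[op/idx]_(0 <= j < (size t).+1) F j.
Proof.
rewrite (perm_big _ (perm_segments t)) big_pairmap_pair ?last_breaks //.
exact: sub_path (fun x y => @ltnW x y) _ _ (breaks_path t).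
Qed.

Lemma sum_seg_length n c : polyomino_chain n c ->
  \sum_(r <- segments c) (seg_length r).-1 = n.-1.
Proof.
case/polyomino_chainP=> t <- ->; rewrite -[RHS]subn0 -[RHS]muln1 -sum_nat_const_nat.
by rewrite -big_segments; apply: eq_bigr => r _; rewrite sum_nat_const_nat muln1.
Qed.

End Segments.

Section SegmentCost.

Local Open Scope ring_scope.

Variables (R : comNzRingType) (f : nat -> nat -> R).

Implicit Types (c : chain) (r : nat * nat) (t : seq bool).

Definition segment_cost (ext : bool) (l : nat) : R :=
  if (l <= 2)%N then if ext then terminal_kink_cost f else kink_kink_cost f
  else medial_medial_cost f *+ (l - 3).

Definition defect c : R :=
  \sum_(r <- segments c) segment_cost (external c r) (seg_length r).

Lemma sum_link_cost_segment t r : (0 < size t)%N -> r \in segments (chain_of_turns t) ->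
  \sum_(r.1 <= j < r.2) link_cost f (kind t j) (kind t j.+1)
    = segment_cost (external (chain_of_turns t) r) (seg_length r).
Proof.
case: r => u v t_gt0 /mem_segments[/andP[lt_uv le_v] break_u break_v straight].
rewrite /external size_chain_of_turns /=.
have v_gt0 : (0 < v)%N := leq_ltn_trans (leq0n u) lt_uv.
have kind_u : kind t u = if u == 0%N then Terminal else Kink.
  by rewrite kind_break ?(ltn_eqF (leq_trans lt_uv le_v)) ?orbF //; lia.
have kind_v : kind t v = if v == (size t).+1 then Terminal else Kink.
  by rewrite kind_break ?(gtn_eqF v_gt0).
have [le_vu|lt_uv1] := leqP v u.+1.
  have eq_v : v = u.+1 by lia.
  rewrite eq_v big_nat1 -eq_v kind_u kind_v /seg_length eq_v /= subSnn -eq_v.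
  by case: eqP => [u0|_]; case: eqP => [v_last|_] //; lia.
have kind_between j : (u < j < v)%N -> kind t j = Medial by move/straight/medialP.
rewrite big_ltn // -(prednK v_gt0) big_nat_recr /=; last by lia.
rewrite (prednK v_gt0) kind_u kind_v !kind_between; try lia.
rewrite (eq_big_nat _ _ (F2 := fun=> medial_medial_cost f)) => [|j lt_ujv]; last first.
  by rewrite !kind_between //; lia.
have -> : link_cost f (if u == 0%N then Terminal else Kink) Medial = 0 by case: ifP.
have -> : link_cost f Medial (if v == (size t).+1 then Terminal else Kink) = 0.
  by case: ifP.
rewrite add0r addr0 sumr_const_nat /segment_cost /seg_length /= ifN; last by lia.
by congr (_ *+ _); lia.
Qed.

Lemma defect_chain_of_turns t : (0 < size t)%N ->
  defect (chain_of_turns t) = turn_cost f t.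
Proof.
move=> t_gt0; rewrite /turn_cost -big_segments.
by apply: eq_big_seq => r r_in; rewrite sum_link_cost_segment.
Qed.

Lemma degree_index_chain (n : nat) c : commutative f -> (2 < n)%N ->
    polyomino_chain n c ->
  degree_index f c = square_weight f * n%:R + base_weight f - defect c.
Proof.
move=> fC n_gt2 /polyomino_chainP[t size_t ->].
have t_gt0 : (0 < size t)%N by lia.
by rewrite defect_chain_of_turns // -size_t; apply: degree_index_directions.
Qed.

End SegmentCost.

Section ExtremalChains.

Implicit Types (m n : nat) (c : chain) (t : seq bool).

Definition all_length3 c : Prop := {in segments c, forall r, seg_length r = 3}.

Lemma all_length3P c :
  reflect (all_length3 c) (all (fun r => seg_length r == 3) (segments c)).
Proof. by apply: (iffP allP) => len3 r /len3 /eqP. Qed.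

Definition one_short_segment c : Prop :=
  exists r, [/\ r \in segments c, internal c r, seg_length r = 2
    & forall r', r' \in segments c -> r' <> r -> seg_length r' = 3].

Lemma polyomino_chain_gt1 n c : polyomino_chain n c -> 1 < n.
Proof. by case/polyomino_chainP=> t <-. Qed.

Lemma sum_seg_length_all_length3 c : all_length3 c ->
  \sum_(r <- segments c) (seg_length r).-1 = (size (segments c)).*2.
Proof.
move=> len3; rewrite -muln2 -sum1_size big_distrl.
by apply: eq_big_seq => r /len3 ->.
Qed.

Lemma AZ1P m c : AZ1 m c <-> polyomino_chain m.*2.+1 c /\ all_length3 c.
Proof.
split=> [[[n chain_c] <- len3]|[chain_c len3]].
  have -> // : (size (segments c)).*2.+1 = n.
  have := sum_seg_length chain_c; have := polyomino_chain_gt1 chain_c.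
  by rewrite sum_seg_length_all_length3 //; lia.
split=> //; first by exists m.*2.+1.
by have := sum_seg_length chain_c; rewrite sum_seg_length_all_length3 //; lia.
Qed.

Lemma sum_seg_length_one_short c : one_short_segment c ->
  (\sum_(r <- segments c) (seg_length r).-1).+1 = (size (segments c)).*2.
Proof.
case=> r [r_in _ len_r len3]; rewrite -muln2 -sum1_size big_distrl.
rewrite !(bigD1_seq r r_in (segments_uniq c)) len_r; congr _.+2.
rewrite big_seq_cond [RHS]big_seq_cond; apply: eq_bigr => r' /andP[r'_in /eqP ne_r'].
by rewrite len3.
Qed.

Lemma AZ2P m c : AZ2 m c <-> polyomino_chain m.*2 c /\ one_short_segment c.
Proof.
split=> [[[n chain_c] <- short]|[chain_c short]].
  have -> // : (size (segments c)).*2 = n.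
  have := sum_seg_length chain_c; have := polyomino_chain_gt1 chain_c.
  by have := sum_seg_length_one_short short; lia.
split=> //; first by exists m.*2.
have := sum_seg_length chain_c; have := polyomino_chain_gt1 chain_c.
by have := sum_seg_length_one_short short; lia.
Qed.

Lemma AZ1_exists m : 0 < m -> exists c, AZ1 m c.
Proof.
move=> m_gt0; pose is_break j := ~~ odd j.
pose t := mkseq (is_break \o succn) m.*2.-1.
have size_t : (size t).+1 = m.*2 by rewrite size_mkseq; lia.
exists (chain_of_turns t); apply/AZ1P; split.
  by apply/polyomino_chainP; exists t; rewrite ?size_t.
move=> [u v] /mem_segments[/andP[lt_uv le_v]].
rewrite !medial_mkseq => break_u break_v straight.
have := straight u.+2.
by rewrite medial_mkseq /seg_length /is_break /= in break_u break_v *; lia.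
Qed.

(* The breaks 2, 3, 5, ..., 2m - 1 make the second segment the short one; it is
   internal because m > 2. *)
Lemma AZ2_exists m : 2 < m -> exists c, AZ2 m c.
Proof.
move=> m_gt2; pose is_break j := (j == 2) || (2 < j) && odd j.
pose t := mkseq (is_break \o succn) m.*2.-2.
have size_t : (size t).+2 = m.*2 by rewrite size_mkseq; lia.
exists (chain_of_turns t); apply/AZ2P; split.
  by apply/polyomino_chainP; exists t.
exists (2, 3); split=> //.
- by apply/mem_segments; rewrite !medial_mkseq /is_break; split=> [|||j]; lia.
- by rewrite /internal /external size_chain_of_turns size_t /=; lia.
move=> [u v] /mem_segments[/andP[lt_uv le_v]].
rewrite !medial_mkseq => break_u break_v straight /eqP; rewrite xpair_eqE.
have := straight u.+1; have := straight u.+2.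
by rewrite !medial_mkseq /seg_length /is_break /= in break_u break_v *; lia.
Qed.

Lemma breaks_inj t t' : breaks t = breaks t' -> t = t'.
Proof.
move=> eq_breaks; have eq_size : size t = size t'.
  by apply: succn_inj; rewrite -!last_breaks eq_breaks.
apply: (@eq_from_nth _ false) => // j lt_j; apply: negb_inj.
have := mem_breaks t j.+1; rewrite eq_breaks mem_breaks.
by rewrite -eq_size !ltnS (ltnW lt_j) /= !medialS -?eq_size // !negbK => ->.
Qed.

Lemma AZ1_unique m c c' : AZ1 m c -> AZ1 m c' -> c = c'.
Proof.
suff breaksE t : AZ1 m (chain_of_turns t) -> breaks t = traject (addn 2) 2 m.
  move=> AZc AZc'; have [[_ /polyomino_chainP[t _ c_t]] _ _] := AZc.
  have [[_ /polyomino_chainP[t' _ c'_t']] _ _] := AZc'; rewrite c_t c'_t' in AZc AZc' *.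
  by congr chain_of_turns; apply: breaks_inj; rewrite !breaksE.
case=> _ <- len3; rewrite (perm_size (perm_segments t)) size_pairmap.
apply: fpathE; rewrite -all_pairmap_pair; apply/allP => r.
rewrite -(perm_mem (perm_segments t)) => r_in; have := seg_length_gt1 r_in.
by have := len3 r r_in; rewrite /seg_length /=; lia.
Qed.

End ExtremalChains.

Section Maximum.

Local Open Scope ring_scope.

Variables (R : realDomainType) (f : nat -> nat -> R).

Implicit Types (n : nat) (c : chain) (r : nat * nat).

Definition kink_kink_cheapest : Prop :=
  [/\ 0 < kink_kink_cost f, kink_kink_cost f < terminal_kink_cost f
    & kink_kink_cost f < medial_medial_cost f].

Hypothesis cheapest : kink_kink_cheapest.

Let kink_kink_gt0 : 0 < kink_kink_cost f. Proof. by case: cheapest. Qed.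

Lemma segment_cost_leif (ext : bool) (l : nat) : l != 3 ->
  kink_kink_cost f <= segment_cost f ext l ?= iff ~~ ext && (l <= 2)%N.
Proof.
have [_ lt_terminal_kink lt_medial_medial] := cheapest.
rewrite /segment_cost => l_neq3; case: leqP => [_|l_gt2].
  by case: ext; [apply/leifP | apply/leif_refl].
have lt_long : kink_kink_cost f < medial_medial_cost f *+ (l - 3).
  have -> : (l - 3 = (l - 4).+1)%N by lia.
  by rewrite mulrS ltr_wpDr // mulrn_wge0 // ltW // (lt_trans kink_kink_gt0).
by rewrite andbF; apply/leifP.
Qed.

Lemma segment_cost_ge0 (ext : bool) (l : nat) : 0 <= segment_cost f ext l.
Proof.
have [->//|l_neq3] := eqVneq l 3.
exact: le_trans (ltW kink_kink_gt0) (segment_cost_leif ext l_neq3).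
Qed.

Lemma segment_cost_eq0 (ext : bool) (l : nat) :
  (segment_cost f ext l == 0) = (l == 3).
Proof.
have [->|l_neq3] := eqVneq l 3; first exact: eqxx.
by apply: gt_eqF; apply: lt_le_trans kink_kink_gt0 (segment_cost_leif ext l_neq3).
Qed.

Lemma defect_ge0 c : 0 <= defect f c.
Proof. by apply: sumr_ge0 => r _; apply: segment_cost_ge0. Qed.

Lemma defect_eq0 c : (defect f c == 0) = all (fun r => seg_length r == 3) (segments c).
Proof.
rewrite psumr_eq0 => [|r _]; last exact: segment_cost_ge0.
by apply: eq_all => r; rewrite segment_cost_eq0.
Qed.

Lemma defect_leif c r : r \in segments c -> seg_length r != 3 ->
  kink_kink_cost f <= defect f c
    ?= iff [&& internal c r, seg_length r == 2
             & all (fun r' => (r' != r) ==> (seg_length r' == 3)) (segments c)].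
Proof.
move=> r_in r_neq3; rewrite /defect (bigD1_seq r) ?segments_uniq //=.
rewrite -[kink_kink_cost f]addr0 andbA; apply: leifD.
  have -> : (seg_length r == 2) = (seg_length r <= 2)%N.
    by rewrite eqn_leq (seg_length_gt1 r_in) andbT.
  exact: segment_cost_leif.
split; first by apply: sumr_ge0 => r' _; apply: segment_cost_ge0.
rewrite eq_sym psumr_eq0 => [|r' _]; last exact: segment_cost_ge0.
by apply: eq_all => r'; rewrite segment_cost_eq0.
Qed.

Lemma defect_ge_kink_kink c : ~ all_length3 c -> kink_kink_cost f <= defect f c.
Proof.
by move/all_length3P/allPn=> [r r_in /(defect_leif r_in)[]].
Qed.

Lemma defect_eq_kink_kink c : defect f c = kink_kink_cost f <-> one_short_segment c.
Proof.
split=> [defect_kk|[r [r_in int_r len_r others]]].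
  have /allPn[r r_in r_neq3] : ~~ all (fun r => seg_length r == 3) (segments c).
    by rewrite -defect_eq0 defect_kk gt_eqF.
  have := eq_leif (defect_leif r_in r_neq3); rewrite defect_kk eqxx.
  case/esym/and3P=> int_r /eqP len_r /allP others; exists r.
  split=> // r' r'_in /eqP r'_neq.
  by apply/eqP; apply: implyP (others r' r'_in) r'_neq.
have r_neq3 : seg_length r != 3 by rewrite len_r.
apply/esym/eqP; rewrite (eq_leif (defect_leif r_in r_neq3)) int_r len_r /=.
by apply/allP => r' r'_in; apply/implyP => /eqP/(others r' r'_in) ->.
Qed.

Lemma odd_all_length3 n c : polyomino_chain n c -> all_length3 c -> odd n.
Proof.
move=> chain_c len3.
have := sum_seg_length chain_c; have := polyomino_chain_gt1 chain_c.
by rewrite sum_seg_length_all_length3 //; lia.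
Qed.

Definition min_defect n : R := kink_kink_cost f *+ ~~ odd n.

Lemma min_defect_le n c : polyomino_chain n c -> min_defect n <= defect f c.
Proof.
move=> chain_c; rewrite /min_defect; case: (boolP (odd n)) => [_|/negP even_n] /=.
  exact: defect_ge0.
by apply: defect_ge_kink_kink => /(odd_all_length3 chain_c).
Qed.

Lemma AZ1_min_defect n c : odd n ->
  AZ1 n./2 c <-> polyomino_chain n c /\ defect f c = min_defect n.
Proof.
move=> odd_n; have n_eq : (n./2).*2.+1 = n by lia.
rewrite AZ1P n_eq /min_defect odd_n mulr0n.
by rewrite (rwP (all_length3P c)) -defect_eq0 -(rwP eqP).
Qed.

Lemma AZ2_min_defect n c : ~~ odd n ->
  AZ2 n./2 c <-> polyomino_chain n c /\ defect f c = min_defect n.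
Proof.
move=> even_n; have n_eq : (n./2).*2 = n by lia.
by rewrite AZ2P n_eq /min_defect even_n mulr1n defect_eq_kink_kink.
Qed.

Lemma min_defect_attained n : (5 <= n)%N ->
  exists2 c, polyomino_chain n c & defect f c = min_defect n.
Proof.
move=> n_ge5; case: (boolP (odd n)) => [odd_n|even_n].
  have [c /(AZ1_min_defect c odd_n)[]] : exists c, AZ1 n./2 c by apply: AZ1_exists; lia.
  by exists c.
have [c /(AZ2_min_defect c even_n)[]] : exists c, AZ2 n./2 c by apply: AZ2_exists; lia.
by exists c.
Qed.

Hypothesis fC : commutative f.

Definition maximizes n c : Prop :=
  polyomino_chain n c /\
  forall c', polyomino_chain n c' -> degree_index f c' <= degree_index f c.

Lemma maximizesP n c : (5 <= n)%N ->
  maximizes n c <-> polyomino_chain n c /\ defect f c = min_defect n.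
Proof.
move=> n_ge5; have n_gt2 : (2 < n)%N by lia.
have index_le c1 c2 : polyomino_chain n c1 -> polyomino_chain n c2 ->
    (degree_index f c1 <= degree_index f c2) = (defect f c2 <= defect f c1).
  by move=> chain1 chain2; rewrite !(degree_index_chain fC n_gt2) // lerD2l lerN2.
split=> -[chain_c c_opt]; split=> //.
  have [c0 chain_c0 c0_opt] := min_defect_attained n_ge5.
  by apply/eqP; rewrite eq_le min_defect_le // andbT -c0_opt -index_le // c_opt.
by move=> c' chain_c'; rewrite index_le // c_opt min_defect_le.
Qed.

Lemma maximizes_AZ1 n c : (5 <= n)%N -> odd n -> maximizes n c <-> AZ1 n./2 c.
Proof. by move=> n_ge5 odd_n; rewrite maximizesP // AZ1_min_defect. Qed.

Lemma maximizes_AZ2 n c : (5 <= n)%N -> ~~ odd n -> maximizes n c <-> AZ2 n./2 c.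
Proof. by move=> n_ge5 even_n; rewrite maximizesP // AZ2_min_defect. Qed.

Lemma maximum_value n : (5 <= n)%N ->
  exists2 c, maximizes n c
    & degree_index f c = square_weight f * n%:R + base_weight f - min_defect n.
Proof.
move=> n_ge5; have [c chain_c c_opt] := min_defect_attained n_ge5.
exists c; first exact/maximizesP.
by rewrite (degree_index_chain fC _ chain_c) ?c_opt //; lia.
Qed.

End Maximum.

Section AugmentedZagreb.

Local Open Scope ring_scope.

(* The index AZI is convertible to degree_index AZI_weight. *)
Definition AZI_weight (i j : nat) : rat := ((i%:R * j%:R) / (i%:R + j%:R - 2)) ^+ 3.

Lemma AZI_weightC : commutative AZI_weight.
Proof. by move=> i j; rewrite /AZI_weight [i%:R * _]mulrC [i%:R + _]addrC. Qed.

Lemma AZI_weight2 (j : nat) : AZI_weight 2 j.+1 = 8.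
Proof.
have j1_neq0 : j.+1%:R != 0 :> rat by rewrite pnatr_eq0.
by rewrite /AZI_weight [2 + _]addrC addrK mulfK //; ring.
Qed.

Lemma AZI_weight33 : AZI_weight 3 3 = 729 / 64.
Proof. by rewrite /AZI_weight; field. Qed.

Lemma AZI_weight34 : AZI_weight 3 4 = 1728 / 125.
Proof. by rewrite /AZI_weight; field. Qed.

Lemma AZI_weight44 : AZI_weight 4 4 = 512 / 27.
Proof. by rewrite /AZI_weight; field. Qed.

Lemma AZI_kink_kink_cost : kink_kink_cost AZI_weight = 2312 / 3375.
Proof. rewrite /kink_kink_cost !AZI_weight2 AZI_weight34 AZI_weight44; lra. Qed.

Lemma AZI_kink_kink_cheapest : kink_kink_cheapest AZI_weight.
Proof.
split; rewrite AZI_kink_kink_cost.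
- lra.
- rewrite /terminal_kink_cost AZI_weight2 AZI_weight33 AZI_weight34; lra.
- rewrite /medial_medial_cost AZI_weight2 AZI_weight33 AZI_weight34; lra.
Qed.

Lemma maxAZIE (n : nat) :
  maxAZI n = square_weight AZI_weight * n%:R + base_weight AZI_weight
               - min_defect AZI_weight n.
Proof.
rewrite /maxAZI /min_defect -mulr_natr AZI_kink_kink_cost /square_weight /base_weight.
by rewrite !AZI_weight2 AZI_weight33 AZI_weight34; lra.
Qed.

End AugmentedZagreb.

Theorem theorem3 (n : nat) (hn : 5 <= n) :
  [/\ odd n ->
        exists c : chain, unique (AZ1 ((n - 1) %/ 2)) c
          /\ forall c' : chain, maximizes_AZI n c' <-> c' = c,
      ~~ odd n ->
        forall c : chain, maximizes_AZI n c <-> AZ2 (n %/ 2) c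
    & exists2 c : chain, maximizes_AZI n c & AZI c = maxAZI n].
Proof.
have AZI_cheapest := AZI_kink_kink_cheapest.
split=> [odd_n|even_n c|].
- have -> : (n - 1) %/ 2 = n./2 by lia.
  have maxE c : maximizes_AZI n c <-> AZ1 n./2 c.
    exact: (maximizes_AZ1 AZI_cheapest AZI_weightC c hn odd_n).
  have [c AZc] : exists c, AZ1 n./2 c by apply: AZ1_exists; lia.
  exists c; split=> [|c']; first by split=> // c'; apply: AZ1_unique.
  by rewrite maxE; split=> [/(AZ1_unique AZc)|->].
- by rewrite divn2; exact: (maximizes_AZ2 AZI_cheapest AZI_weightC c hn even_n).
- by rewrite maxAZIE; exact: (maximum_value AZI_cheapest AZI_weightC hn).
Qed.
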